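(* Let $\mathcal{H}$ be a $k$-uniform hypertree with $k \geq 3$, and let $\lambda \in \mathbb{C}$ with $\lambda \neq 0$. Then $\lambda$ is an eigenvalue of $\mathcal{H}$ if and only if there exists a vertex set $U \subseteq V(\mathcal{H})$ such that the induced subhypergraph $H = \mathcal{H}[U]$ is connected (hence itself a $k$-uniform hypertree) and $\lambda$ is a root of the matching polynomial $\varphi(H)$.
   Context: A $k$-uniform hypergraph $\mathcal{H}$ on vertex set $[n]$ has normalized adjacency tensor $A=(a_{i_1\dots i_k})$ of order $k$ and dimension $n$, where $a_{i_1 i_2\dots i_k} = \frac{1}{(k-1)!}$ if $\{i_1,\dots,i_k\}$ is an edge of $\mathcal{H}$ and $0$ otherwise. A pair $(\lambda,\mathbf{x})\in\mathbb{C}\times(\mathbb{C}^n\setminus\{0\})$ is an eigenpair (and $\lambda$ an eigenvalue) of $\mathcal{H}$ if $\sum_{i_2,\dots,i_k=1}^n a_{j i_2\dots i_k}x_{i_2}\cdots x_{i_k} = \lambda x_j^{k-1}$ for all $j\in[n]$. A $k$-uniform hypertree is a connected acyclic $k$-uniform hypergraph. For $U\subseteq V(\mathcal{H})$, the induced subhypergraph is $\mathcal{H}[U]=(U,\{e\in E(\mathcal{H}) : e\subseteq U\})$. A $t$-matching of $H$ is a set of $t$ pairwise disjoint edges. The matching polynomial of a $k$-uniform hypergraph $H$ is $\varphi(H)=\sum_{i=0}^{m}(-1)^i|\mathcal{M}_i|\,x^{(m-i)k}$, where $\mathcal{M}_i$ is the set of $i$-matchings of $H$ and $m$ is the maximum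 size of a matching in $H$. *)

(* Defs.v *)
From HB Require Import structures.
From mathcomp Require Import all_boot all_order all_algebra.
Set Implicit Arguments. Unset Strict Implicit. Unset Printing Implicit Defensive.
Import Order.TTheory GRing.Theory Num.Theory.

(* A hypergraph on vertex set [n] = 'I_n is given by its edge set
   E : {set {set 'I_n}} (an edge is a set of vertices). *)

Definition kuniform (n k : nat) (E : {set {set 'I_n}}) : Prop :=
  forall e, e \in E -> #|e| = k.

Definition hadj (n : nat) (E : {set {set 'I_n}}) : rel 'I_n :=
  fun u v => [exists e in E, (u \in e) && (v \in e)].

Definition hconnected (n : nat) (V : {set 'I_n}) (E : {set {set 'I_n}}) : Prop :=
  forall u v, u \in V -> v \in V -> connect (hadj E) u v.

Definition has_berge_cycle (n : nat) (E : {set {set 'I_n}}) : Prop :=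
  exists (t : nat) (vs : 'I_t -> 'I_n) (es : 'I_t -> {set 'I_n}),
    [/\ 2 <= t, injective vs, injective es &
        forall i : 'I_t, [/\ es i \in E, vs i \in es i & vs (ordS i) \in es i]].

Definition hypertree (n : nat) (V : {set 'I_n}) (E : {set {set 'I_n}}) : Prop :=
  hconnected V E /\ ~ has_berge_cycle E.

Definition induced (n : nat) (E : {set {set 'I_n}}) (U : {set 'I_n})
  : {set {set 'I_n}} := [set e in E | e \subset U].

Definition is_matching (n : nat) (E : {set {set 'I_n}}) (M : {set {set 'I_n}}) : bool :=
  (M \subset E) &&
  [forall e1 in M, forall e2 in M, (e1 != e2) ==> [disjoint e1 & e2]].

Definition matchings (n : nat) (E : {set {set 'I_n}}) (i : nat)
  : {set {set {set 'I_n}}} := [set M | is_matching E M & #|M| == i].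

Definition max_matching (n : nat) (E : {set {set 'I_n}}) : nat :=
  \max_(M : {set {set 'I_n}} | is_matching E M) #|M|.

Local Open Scope ring_scope.

Definition matching_poly (R : nzRingType) (k n : nat) (E : {set {set 'I_n}})
  : {poly R} :=
  let m := max_matching E in
  \sum_(i < m.+1) ((-1) ^+ i * (#|matchings E i|)%:R) *: 'X^((m - i) * k).

(* Normalized adjacency tensor of order k: entry a_{j i_2 ... i_k}, where the
   indices i_2..i_k are given by t : 'I_(k-1) -> 'I_n. *)
Definition adj_tensor (F : fieldType) (k n : nat) (E : {set {set 'I_n}})
  (j : 'I_n) (t : {ffun 'I_k.-1 -> 'I_n}) : F :=
  if (j |: [set t i | i : 'I_k.-1]) \in E then ((k.-1)`!%:R)^-1 else 0.

Definition is_eigenpair (F : fieldType) (k n : nat) (E : {set {set 'I_n}})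
  (lam : F) (x : 'I_n -> F) : Prop :=
  (exists j, x j != 0) /\
  forall j : 'I_n,
    \sum_(t : {ffun 'I_k.-1 -> 'I_n}) @adj_tensor F k n E j t * \prod_(i : 'I_k.-1) x (t i)
    = lam * x j ^+ k.-1.

Arguments adj_tensor F k {n} E j t.
Arguments is_eigenpair F k {n} E lam x.

Definition is_eigenvalue (F : fieldType) (k n : nat) (E : {set {set 'I_n}})
  (lam : F) : Prop := exists x : 'I_n -> F, @is_eigenpair F k n E lam x.

Arguments is_eigenvalue F k {n} E lam.
Arguments matching_poly R k {n} E.

(* Main.v *)
(** Put [y = lam ^- k]. For [lam <> 0], [lam] is a root of the matching polynomial of an
    edge set [F] iff the sum of [(-y)^|M|] over the matchings [M] of [F] vanishes; this
    sum is multiplicative over disjoint unions and satisfies deletion recurrences.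

    If [x] is an eigenvector, let [U] be a connected component of its support and put
    [beta v e = x^e / (lam * x_v ^ k)], where [x^e] is the product of [x] over [e]. Then
    [beta v e] sums to 1 over the edges [e] at [v] and multiplies to [y] over the vertices
    [v] of [e]. Working up from the leaves, [beta v e] is a ratio of matching sums of
    branches, and the equation at the root says that the matching sum of [U] vanishes.

    Conversely, take [U] minimal with vanishing matching sum; it is connected. Let [z_v]
    be the matching sum of [U - v] and [w_e] that of [U - e], all nonzero by minimality.
    Then [z_v] is the sum of [y * w_e] over the edges at [v], and the product of [z] over
    [e] is [(lam * y * w_e) ^ k]. Since the hypergraph is acyclic, the k-th roots [x_v] of
    [z_v] can be chosen so that [x^e = lam * y * w_e] for every edge, and [x], extended
    by 0 outside [U], is an eigenvector. *)

Require Import Defs.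
From HB Require Import structures.
From mathcomp Require Import all_boot all_order all_algebra.
From mathcomp Require Import zify ring.
Import Order.TTheory GRing.Theory Num.Theory.
Local Open Scope ring_scope.
Set Implicit Arguments. Unset Strict Implicit. Unset Printing Implicit Defensive.

(** * Components, Berge cycles and cutting at an edge *)

Section Connectivity.

Variable n : nat.
Implicit Types (E F G : {set {set 'I_n}}) (e f g U : {set 'I_n}) (u v r : 'I_n).

Definition component_edges F r : {set {set 'I_n}} :=
  [set f in F | [exists v in f, connect (hadj F) r v]].

(** Only edge sets are kept, since isolated vertices do not affect matchings. This stands for the
    hypergraph minus [v], and [avoid F e] for the hypergraph minus all vertices of [e]. *)
Definition delete_vertex F v : {set {set 'I_n}} := [set f in F | v \notin f].

Definition avoid F e : {set {set 'I_n}} := [set f in F | [disjoint f & e]].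

Lemma hadjP F u v :
  reflect (exists e, [/\ e \in F, u \in e & v \in e]) (hadj F u v).
Proof.
apply: (iffP existsP) => [[e /andP[eF /andP[ue ve]]]|[e [eF ue ve]]]; exists e => //.
by rewrite eF ue.
Qed.

Lemma hadj_sym F : symmetric (hadj F).
Proof. by move=> u v; apply/hadjP/hadjP => -[e [? ? ?]]; exists e. Qed.

Lemma connect_hadjC F : connect_sym (hadj F).
Proof. exact/sym_connect_sym/hadj_sym. Qed.

Lemma hadj_edge F e u v : e \in F -> u \in e -> v \in e -> hadj F u v.
Proof. by move=> eF ue ve; apply/hadjP; exists e. Qed.

Lemma connect_edge F e u v : e \in F -> u \in e -> v \in e -> connect (hadj F) u v.
Proof. by move=> eF ue ve; apply/connect1/(hadj_edge eF). Qed.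

Lemma connect_hadjS F G u v :
  F \subset G -> connect (hadj F) u v -> connect (hadj G) u v.
Proof.
move=> /subsetP sFG; apply: connect_sub => a b /hadjP[e [eF ae be]].
exact: connect_edge (sFG _ eF) ae be.
Qed.

(** Induction on a path extended at its far end, so that the step may use that [a] is already
    reached from [x]. *)
Lemma connect_invariant (T : finType) (e : rel T) (P : T -> Prop) x y :
  (forall a b, connect e x a -> P a -> e a b -> P b) -> P x -> connect e x y -> P y.
Proof.
move=> step Px /connectP[p]; elim/last_ind: p y => [|p b IH] y /=.
  by move=> _ ->.
rewrite rcons_path last_rcons => /andP[xp pb] ->.
by apply: step pb; [apply/connectP; exists p | exact: IH].
Qed.

Lemma mem_component F r f v :
  f \in component_edges F r -> v \in f -> connect (hadj F) r v.
Proof.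
rewrite inE => /andP[fF /existsP[w /andP[wf rw]]] vf.
exact: connect_trans rw (connect_edge fF wf vf).
Qed.

Lemma component_edgeI F r f v :
  f \in F -> v \in f -> connect (hadj F) r v -> f \in component_edges F r.
Proof. by move=> fF vf rv; rewrite inE fF; apply/existsP; exists v; rewrite vf. Qed.

Lemma component_edges_sub F r : component_edges F r \subset F.
Proof. by apply/subsetP => f; rewrite inE => /andP[]. Qed.

Lemma connect_component F r v :
  connect (hadj F) r v -> connect (hadj (component_edges F r)) r v.
Proof.
apply: (connect_invariant (P := connect _ r)) => // a b ra ca /hadjP[e [eF ae be]].
exact: connect_trans ca (connect_edge (component_edgeI eF ae ra) ae be).
Qed.

Lemma has_berge_cycleS F G : F \subset G -> has_berge_cycle F -> has_berge_cycle G.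
Proof.
move=> /subsetP sFG [t [vs [es [t2 vi ei H]]]]; exists t, vs, es; split => // i.
by have [? ? ?] := H i; split => //; apply: sFG.
Qed.

(* A repetition of a vertex or of an edge allows the walk to be shortened; a walk
   without repetitions closes up with [e] into a Berge cycle. *)
Lemma walk_closing_edge F e l (vs : nat -> 'I_n) (es : nat -> {set 'I_n}) :
    ~ has_berge_cycle F -> e \in F -> vs 0%N \in e -> vs l \in e ->
    (forall i, (i < l)%N -> [/\ es i \in F :\ e, vs i \in es i & vs i.+1 \in es i]) ->
  vs 0%N = vs l.
Proof.
move=> acF eF; have [m] := ubnP l; elim: m => // m IH in l vs es *.
rewrite ltnS => lm v0e vle walk.
have shortcut i j : (i < j <= l)%N ->
    (vs i = vs j \/ (j < l)%N /\ es i = es j) -> vs 0%N = vs l.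
  move=> /andP[ij jl] eqij; pose d := (j - i)%N.
  (* Both shortcuts drop [d] steps. A repeated vertex removes the edges [i] to [j - 1]; a repeated
     edge removes the vertices [i + 1] to [j], and [es i] then leads from [vs i] to [vs j.+1]. The
     singly and doubly primed versions differ only at index [i]. *)
  pose vs' a := if (a <= i)%N then vs a else vs (a + d)%N.
  pose vs'' a := if (a < i)%N then vs a else vs (a + d)%N.
  pose es' a := if (a <= i)%N then es a else es (a + d)%N.
  pose es'' a := if (a < i)%N then es a else es (a + d)%N.
  case: eqij => [eqv|[jl' eqe]].
    have idj : (i + d = j)%N by rewrite /d; lia.
    have vE a : vs'' a = vs' a.
      by rewrite /vs'' /vs'; case: ltngtP => // ->; rewrite idj eqv.
    have v''0 : vs'' 0%N = vs 0%N by rewrite vE.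
    have v''l : vs'' (l - d)%N = vs l.
      rewrite /vs''; case: ltnP => h; first by rewrite /d in h; lia.
      by congr vs; rewrite /d; lia.
    rewrite -v''0 -v''l; apply: (IH (l - d)%N vs'' es''); rewrite ?v''0 ?v''l //.
      by rewrite /d; lia.
    move=> a al; rewrite [vs'' a.+1]vE /vs'' /vs' /es''; case: ltnP => h.
      by apply: walk; lia.
    by rewrite addSn; apply: walk; rewrite /d in al *; lia.
  have idj : (i + d = j)%N by rewrite /d; lia.
  have v'l : vs' (l - d)%N = vs l.
    rewrite /vs'; case: leqP => h; first by rewrite /d in h; lia.
    by congr vs; rewrite /d; lia.
  have v'0 : vs' 0%N = vs 0%N by [].
  rewrite -v'0 -v'l; apply: (IH (l - d)%N vs' es'); rewrite ?v'0 ?v'l //.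
    by rewrite /d; lia.
  move=> a al; rewrite /vs' /es'; have [ai|ai|->] := ltngtP a i.
  - by apply: walk; lia.
  - by rewrite addSn; apply: walk; rewrite /d in al *; lia.
  have [? ? _] := walk i ltac:(lia); have [_ _ ?] := walk j jl'.
  by split => //; rewrite addSn idj eqe.
have [l0|lpos] := posnP l; first by rewrite l0.
have [/injectiveP vinj|] := boolP (injectiveb (fun i : 'I_l.+1 => vs i)); last first.
  case/injectivePn => i [j ij eqv].
  have [h|h|h] := ltngtP i j; last by case/eqP: ij; apply: val_inj.
    by apply: (shortcut i j); [rewrite h -ltnS ltn_ord | left].
  by apply: (shortcut j i); [rewrite h -ltnS ltn_ord | left].
have [/injectiveP einj|] := boolP (injectiveb (fun i : 'I_l => es i)); last first.
  case/injectivePn => i [j ij eqv].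
  have [h|h|h] := ltngtP i j; last by case/eqP: ij; apply: val_inj.
    by apply: (shortcut i j); [rewrite h ltnW | right].
  by apply: (shortcut j i); [rewrite h ltnW | right].
(* The walk has [l + 1] vertices and [l] edges; [e] is the last edge of the cycle, from [vs l] back
   to [vs 0]. *)
case: acF; exists l.+1, (fun i => vs i), (fun i => if (i < l)%N then es i else e).
have neq i : (i < l)%N -> es i <> e.
  by move=> il; have [] := walk i il; rewrite !inE => /andP[/eqP].
split => //.
- move=> i j; have := ltn_ord i; have := ltn_ord j; rewrite !ltnS => jl il.
  case: ltnP => hi; case: ltnP => hj eqe.
  + have := einj (Ordinal hi) (Ordinal hj) eqe => /(congr1 val) /= ?; exact: val_inj.
  + by case: (neq i hi).
  + by case: (neq j hj).
  + by apply: val_inj => /=; lia.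
- move=> i; have := ltn_ord i; rewrite ltnS => il /=.
  case: ltnP => hi.
    have [] := walk i hi; rewrite !inE => /andP[_ ->] ? ?.
    by rewrite modn_small // ltnS.
  have -> : i = l :> nat by lia.
  by rewrite modnn.
Qed.

(** A path avoiding [e] between two of its vertices would be closed up by [e]. This is the form in
    which acyclicity is used from here on. *)
Lemma acyclic_edge_cut F e u v :
    ~ has_berge_cycle F -> e \in F -> u \in e -> v \in e ->
  connect (hadj (F :\ e)) u v -> u = v.
Proof.
move=> acF eF ue ve /connectP[p /(pathP u) up vE].
pose vs := nth u (u :: p).
(* An edge is picked for each step of the path; the default [set0] does not occur for indices below
   [size p]. *)
pose es i := odflt set0 [pick f in F :\ e | (vs i \in f) && (vs i.+1 \in f)].
have vlast : vs (size p) = v by rewrite /vs vE nth_last; case: p {up vE vs es}.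
rewrite -vlast; apply: (@walk_closing_edge F e (size p) vs es); rewrite ?vlast //.
move=> i ip; rewrite /es; case: pickP => [f /and3P[]//|none].
have /existsP[f] := up i ip; rewrite -[nth u p i]/(vs i.+1) -[nth u _ i]/(vs i).
by have /= -> := none f.
Qed.

End Connectivity.

(** * Matching sums, their recurrences and multiplicativity *)

Section MatchingSum.

Variables (R : fieldType) (n : nat) (y : R).
Implicit Types (E F G M : {set {set 'I_n}}) (e f g U : {set 'I_n}) (u v r : 'I_n).

(* The matching polynomial of [F] divided by its leading monomial, evaluated where
   [x ^- k] equals [y]. *)
Definition matching_sum F : R := \sum_(M | is_matching F M) (- y) ^+ #|M|.

Lemma matchingP F M :
  reflect ({subset M <= F} /\ {in M &, forall e f, e != f -> [disjoint e & f]})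
          (is_matching F M).
Proof.
apply: (iffP andP) => -[/subsetP sMF dM]; split => //.
  by move=> e f eM fM ef; move/forall_inP/(_ e eM)/forall_inP/(_ f fM)/implyP: dM; apply.
by apply/forall_inP => e eM; apply/forall_inP => f fM; apply/implyP; apply: dM.
Qed.

Lemma matching_sum0 : matching_sum set0 = 1.
Proof.
rewrite /matching_sum (bigD1 set0) /=; last first.
  by apply/matchingP; split=> e; rewrite inE.
rewrite cards0 expr0 big1 ?addr0 // => M /andP[/andP[M0 _] /negP[]].
by rewrite -subset0.
Qed.

(** Matchings containing [e] correspond, by removing [e], to those of [avoid F e], at the cost of a
    factor [- y]. An empty [e] would be disjoint from itself and remain in [avoid F e]. *)
Lemma matching_sum_edge F e : e \in F -> e != set0 ->
  matching_sum F = matching_sum (F :\ e) - y * matching_sum (avoid F e).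
Proof.
move=> eF e0; rewrite /matching_sum (bigID (fun M : {set {set 'I_n}} => e \in M)) /= addrC.
congr (_ + _).
  by apply: eq_bigl => M; rewrite /is_matching subsetD1 andbAC.
have eav M : is_matching (avoid F e) M -> e \notin M.
  move=> /matchingP[sM _]; apply/negP => /sM; rewrite inE => /andP[_].
  by rewrite -setI_eq0 setIid (negPf e0).
rewrite (reindex_onto (fun M => e |: M) (fun M => M :\ e)) /=; last first.
  by move=> M /andP[_ eM]; rewrite setD1K.
rewrite -mulNr big_distrr /=; apply: eq_big => [M|M /andP[_ /eqP eM]]; last first.
  by rewrite cardsU1 -[in e \notin M]eM setD11 add1n exprS.
apply/idP/idP => [/andP[/andP[/matchingP[sM dM] _] /eqP eM]|mM].
  have eNM : e \notin M by rewrite -eM setD11.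
  apply/matchingP; split => [f fM|f g fM gM]; last by apply: (dM f g); rewrite in_setU ?fM ?gM orbT.
  rewrite inE sM ?inE ?fM ?orbT //=; apply: dM; rewrite ?inE ?fM ?eqxx ?orbT //.
  by apply: contraNneq eNM => <-.
rewrite setU1K ?eav // eqxx setU11 !andbT.
move/matchingP: mM => [sM dM].
have dis f : f \in M -> [disjoint f & e] by move=> /sM; rewrite inE => /andP[].
apply/matchingP; split => [f|f g].
  by rewrite !inE => /predU1P[->//|/sM]; rewrite inE => /andP[].
rewrite !inE => /predU1P[->|fM] /predU1P[->|gM]; rewrite ?eqxx // => fg.
- by rewrite disjoint_sym; apply: dis.
- exact: dis.
- exact: dM.
Qed.

Lemma avoid_sub F e : avoid F e \subset F.
Proof. by apply/subsetP => f; rewrite inE => /andP[]. Qed.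

(** Induction on the size of [F]: the recurrence at an edge of [F] acts on both sides alike, because
    every edge of [G] avoids it. *)
Lemma matching_sumU F G : set0 \notin F ->
    (forall f g, f \in F -> g \in G -> [disjoint f & g]) ->
  matching_sum (F :|: G) = matching_sum F * matching_sum G.
Proof.
have [m] := ubnP #|F|; elim: m => // m IH in F *; rewrite ltnS => Fm F0 dFG.
have [->|/set0Pn[e eF]] := eqVneq F set0; first by rewrite set0U matching_sum0 mul1r.
have e0 : e != set0 by apply: contraNneq F0 => <-.
have eG : e \notin G.
  by apply: contra e0 => /(dFG e e eF); rewrite -setI_eq0 setIid.
have cF' : (#|F :\ e| < m)%N by move: Fm; rewrite (cardsD1 e F) eF.
have IHs F' : F' \subset F :\ e ->
    matching_sum (F' :|: G) = matching_sum F' * matching_sum G.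
  move=> sF'; have sF'F := subset_trans sF' (subD1set F e).
  apply: IH; first exact: leq_ltn_trans (subset_leq_card sF') cF'.
    by apply: contra F0; apply: (subsetP sF'F).
  by move=> f g /(subsetP sF'F); apply: dFG.
have sav : avoid F e \subset F :\ e.
  rewrite subsetD1 avoid_sub inE eF /=.
  by rewrite -setI_eq0 setIid.
rewrite (matching_sum_edge (F := F :|: G) (e := e)) ?inE ?eF //.
rewrite (matching_sum_edge eF) // mulrBl -mulrA -!IHs //.
congr (matching_sum _ - y * matching_sum _); apply/setP => f; rewrite !inE.
  by case: eqP => // ->; rewrite (negPf eG).
case fG: (f \in G); rewrite ?orbT ?orbF //=.
by rewrite disjoint_sym dFG.
Qed.

(** Splits off one class at a time. The classes [P u] may exceed [G], so that one family of branches
    serves for all edge sets [G] of interest. *)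
Lemma matching_sum_prod G (A : {set 'I_n}) (P : 'I_n -> {set {set 'I_n}}) :
    set0 \notin G ->
    (forall f, f \in G -> exists2 u, u \in A & f \in P u) ->
    (forall u v f g, u \in A -> v \in A -> f \in P u -> g \in P v -> u != v ->
       [disjoint f & g]) ->
  matching_sum G = \prod_(u in A) matching_sum (G :&: P u).
Proof.
have [m] := ubnP #|A|; elim: m => // m IH in A G *; rewrite ltnS => Am G0 cov dis.
have [A0|[u uA]] := set_0Vmem A.
  rewrite A0 big_set0 (_ : G = set0) ?matching_sum0 //; apply/setP => f; rewrite inE.
  by apply/negP => /cov[u]; rewrite A0 inE.
rewrite (big_setD1 u) //=.
have GE : G = (G :&: P u) :|: (G :\: P u) by rewrite setID.
rewrite {1}GE matching_sumU; last 2 first.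
- by rewrite inE (negPf G0).
- move=> f g /setIP[fG fu] /setDP[gG gu]; have [v vA gv] := cov g gG.
  by apply: (dis u v) => //; apply: contraNneq gu => ->.
congr (_ * _); rewrite (IH (A :\ u)).
- apply: eq_bigr => v /setD1P[vu vA]; congr matching_sum; apply/setP => f; rewrite !inE.
  case fG: (f \in G); case fv: (f \in P v); rewrite ?andbF ?andbT //=.
  apply: contraNN G0 => fu; have := dis u v f f uA vA fu fv; rewrite eq_sym => /(_ vu).
  by rewrite -setI_eq0 setIid => /eqP <-.
- by move: Am; rewrite (cardsD1 u A) uA.
- by rewrite inE (negPf G0) andbF.
- move=> f /setDP[fG fu]; have [v vA fv] := cov f fG; exists v => //.
  by rewrite !inE vA andbT; apply: contraNneq fu => <-.
- by move=> a b f g /setD1P[_ aA] /setD1P[_ bA]; apply: dis.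
Qed.

(** The edge recurrence is applied to the edges at [v] one by one; removing [e] leaves [avoid F f]
    unchanged for another edge [f] at [v], as [e] and [f] meet in [v]. *)
Lemma matching_sum_star F v :
  matching_sum F =
    matching_sum (delete_vertex F v) - y * \sum_(e in F | v \in e) matching_sum (avoid F e).
Proof.
have [m] := ubnP #|F|; elim: m => // m IH in F *; rewrite ltnS => Fm.
have [/exists_inP[e eF ve]|none] := boolP [exists e in F, v \in e]; last first.
  have vF f : f \in F -> v \notin f.
    by move=> fF; apply: contra none => vf; apply/exists_inP; exists f.
  rewrite big_pred0 ?mulr0 ?subr0; last first.
    by move=> f; apply/negP => /andP[/vF/negP].
  by congr matching_sum; apply/setP => f; rewrite inE; case: (boolP (f \in F)) => // /vF ->.
rewrite (matching_sum_edge eF); last by apply/set0Pn; exists v.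
rewrite IH; last by move: Fm; rewrite (cardsD1 e F) eF.
rewrite [in RHS](bigD1 e) /= ?eF // mulrDr opprD addrA addrAC.
have -> : delete_vertex (F :\ e) v = delete_vertex F v.
  by apply/setP => f; rewrite !inE; case: eqP => //= ->; rewrite ve andbF.
congr (_ - _ - _); congr (_ * _); apply: eq_big => [f|f /andP[_ vf]].
  by rewrite !inE; case: (f == e); rewrite ?andbF ?andbT.
congr matching_sum; apply/setP => g; rewrite !inE; case: eqP => //= ->.
by apply/esym/andP => -[_ /disjoint_setI0/setP/(_ v)]; rewrite !inE ve vf.
Qed.

End MatchingSum.

(** * Splitting a tree at an edge into branches *)

Section EdgeSplitting.

Variables (R : fieldType) (n : nat) (y : R).
Implicit Types (E F G : {set {set 'I_n}}) (e f g U : {set 'I_n}) (u v r : 'I_n).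

(** Connectedness around a root that may itself lie on no edge, which allows the empty branch at a
    leaf. *)
Definition reaches F r : Prop :=
  forall f v, f \in F -> v \in f -> connect (hadj F) r v.

Lemma reaches_component F r : reaches (component_edges F r) r.
Proof. by move=> f v fC vf; apply/connect_component/(mem_component fC). Qed.

Definition branch F e u : {set {set 'I_n}} := component_edges (F :\ e) u.

Lemma branch_sub F e u : branch F e u \subset F :\ e.
Proof. exact: component_edges_sub. Qed.

Lemma branch_acyclic F e u : ~ has_berge_cycle F -> ~ has_berge_cycle (branch F e u).
Proof.
move=> acF; apply: contra_not acF; apply: has_berge_cycleS.
exact: subset_trans (branch_sub _ _ _) (subD1set F e).
Qed.

Lemma branch_card F e u : e \in F -> (#|branch F e u| < #|F|)%N.
Proof. by move=> eF; rewrite (cardsD1 e F) eF ltnS subset_leq_card ?branch_sub. Qed.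

Variables (F : {set {set 'I_n}}) (e : {set 'I_n}).
Hypotheses (acF : ~ has_berge_cycle F) (eF : e \in F) (F0 : set0 \notin F).

Lemma branch_meet u v f : u \in e -> v \in e -> f \in branch F e u -> v \in f -> v = u.
Proof.
move=> ue ve fu vf; apply/esym/(acyclic_edge_cut acF eF ue ve).
exact: mem_component fu vf.
Qed.

Lemma branch_disjoint u v f g : u \in e -> v \in e ->
  f \in branch F e u -> g \in branch F e v -> u != v -> [disjoint f & g].
Proof.
move=> ue ve fu gv; apply: contraNT; rewrite -setI_eq0 => /set0Pn[w /setIP[wf wg]].
apply/eqP/(acyclic_edge_cut acF eF ue ve).
apply: connect_trans (mem_component fu wf) _.
by rewrite connect_hadjC (mem_component gv wg).
Qed.

(** Away from its root a branch keeps all edges at its vertices, so vertex equations carry over to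
    the branch. *)
Lemma branch_incident u v f g : u \in e -> f \in branch F e u -> v \in f -> v != u ->
  g \in F -> v \in g -> g \in branch F e u.
Proof.
move=> ue fu vf vu gF vg; apply: (component_edgeI _ vg (mem_component fu vf)).
rewrite !inE gF andbT; apply: contraNneq vu => ge.
have ve : v \in e by rewrite -ge.
by rewrite (branch_meet ue ve fu vf).
Qed.

Lemma branch_incident_root u g : u \in e ->
  (g \in branch F e u) && (u \in g) = [&& g \in F, u \in g & g != e].
Proof.
move=> ue; apply/andP/and3P => [[gu ug]|[gF ug ge]].
  by have /setD1P[ge gF] := subsetP (branch_sub F e u) g gu.
by split => //; apply: component_edgeI ug (connect0 _ _); rewrite !inE ge.
Qed.

Variable r : 'I_n.
Hypotheses (re : r \in e) (rF : reaches F r).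

(** Along a path from [r], each passage through [e] restarts the connection at the vertex where [e]
    is left. *)
Lemma branch_cover f : f \in F :\ e -> exists2 u, u \in e & f \in branch F e u.
Proof.
move=> fF'; have /setD1P[_ fF] := fF'.
have /set0Pn[v vf] : f != set0 by apply: contraNneq F0 => <-.
suff [u ue uv] : exists2 u, u \in e & connect (hadj (F :\ e)) u v.
  by exists u => //; apply: component_edgeI vf uv.
apply: (connect_invariant (P := fun v => exists2 u, u \in e & connect (hadj (F :\ e)) u v))
  (rF fF vf); last by exists r.
move=> a b _ [u ue ua] /hadjP[g [gF ag bg]].
have [ge|ge] := eqVneq g e; first by exists b; rewrite -?ge.
exists u => //; apply: connect_trans ua (connect_edge (e := g) _ ag bg).
by rewrite !inE ge.
Qed.

Lemma matching_sum_split G : G \subset F :\ e ->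
  matching_sum y G = \prod_(u in e) matching_sum y (G :&: branch F e u).
Proof.
move=> sG; apply: matching_sum_prod.
- by apply: contra F0 => /(subsetP sG)/setD1P[].
- by move=> f /(subsetP sG)/branch_cover.
- exact: branch_disjoint.
Qed.

Lemma matching_sum_del_edge :
  matching_sum y (F :\ e) = \prod_(u in e) matching_sum y (branch F e u).
Proof.
rewrite matching_sum_split //; apply: eq_bigr => u _.
by rewrite (setIidPr (branch_sub F e u)).
Qed.

(** Deleting [v] destroys [e] and changes only the branch at [v], since the other branches miss
    [v]. *)
Lemma matching_sum_delete_vertex v : v \in e ->
  matching_sum y (delete_vertex F v) =
    matching_sum y (delete_vertex (branch F e v) v)
    * \prod_(u in e :\ v) matching_sum y (branch F e u).
Proof.
move=> ve; rewrite matching_sum_split; last first.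
  apply/subsetP => f; rewrite !inE => /andP[-> vf]; rewrite andbT.
  by apply: contraNneq vf => ->.
have bF u f : f \in branch F e u -> f \in F.
  by move=> /(subsetP (branch_sub F e u))/setD1P[].
rewrite (big_setD1 v) //=; congr (_ * _).
  congr matching_sum; apply/setP => f; rewrite in_setI ![_ \in delete_vertex _ _]inE.
  by case fb: (f \in branch F e v); rewrite ?andbF ?(bF _ _ fb) ?andbT.
apply: eq_bigr => u /setD1P[uv ue]; congr matching_sum; apply/setP => f.
rewrite in_setI [_ \in delete_vertex _ _]inE.
case fb: (f \in branch F e u); rewrite ?andbF ?(bF _ _ fb) ?andbT //=.
by apply: contraNN uv => vf; rewrite (branch_meet ue ve fb vf).
Qed.

(** The branch at [u] can meet [e] only in [u], so avoiding [e] amounts to deleting the root of each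
    branch. *)
Lemma matching_sum_avoid :
  matching_sum y (avoid F e)
  = \prod_(u in e) matching_sum y (delete_vertex (branch F e u) u).
Proof.
rewrite matching_sum_split; last first.
  rewrite subsetD1 avoid_sub inE eF -setI_eq0 setIid /=.
  by apply: contraNneq F0 => <-.
have bF u f : f \in branch F e u -> f \in F.
  by move=> /(subsetP (branch_sub F e u))/setD1P[].
apply: eq_bigr => u ue; congr matching_sum; apply/setP => f.
rewrite in_setI [_ \in delete_vertex _ _]inE [_ \in avoid _ _]inE.
case fb: (f \in branch F e u); rewrite ?andbF ?(bF _ _ fb) ?andbT //=.
apply/idP/idP => [fe|uf].
  by apply/negP => uf; move/disjoint_setI0/setP/(_ u): fe; rewrite !inE uf ue.
rewrite -setI_eq0; apply: contraNT uf => /set0Pn[v /setIP[vf ve]].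
by rewrite -(branch_meet ue ve fb vf).
Qed.

End EdgeSplitting.

(* [beta u e] plays the role of [x^e / (lam * x_u ^ k)]. Splitting at the edges through
   the root shows that it must equal the ratio of the matching sums of the branch at
   [u], with and without [u]. *)
Lemma matching_sum_rooted (R : fieldType) (n : nat) (y : R) (F : {set {set 'I_n}})
    (r : 'I_n) (beta : 'I_n -> {set 'I_n} -> R) :
    ~ has_berge_cycle F -> set0 \notin F -> reaches F r -> y != 0 ->
    (forall e, e \in F -> \prod_(v in e) beta v e = y) ->
    (forall v f, v != r -> f \in F -> v \in f -> \sum_(e in F | v \in e) beta v e = 1) ->
  matching_sum y (delete_vertex F r) != 0 /\
  matching_sum y F =
    matching_sum y (delete_vertex F r) * (1 - \sum_(e in F | r \in e) beta r e).
Proof.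
have [m] := ubnP #|F|; elim: m => // m IH in F r *.
rewrite ltnS => Fm acF F0 rF y0 betaM betaD.
have branchIH e u : e \in F -> r \in e -> u \in e ->
    matching_sum y (delete_vertex (branch F e u) u) != 0 /\
    (u != r -> matching_sum y (branch F e u) =
       matching_sum y (delete_vertex (branch F e u) u) * beta u e).
  move=> eF re ue; have sbF := subset_trans (branch_sub F e u) (subD1set F e).
  have [|||||e' e'u|v f vu fu vf|nz ->] := IH (branch F e u) u => //.
  - exact: leq_trans (branch_card _ eF) Fm.
  - exact: branch_acyclic.
  - by apply: contra F0; apply: (subsetP sbF).
  - exact: reaches_component.
  - by apply: betaM; apply: (subsetP sbF).
  - rewrite -(betaD v f) ?(subsetP sbF _ fu) //; last first.
      apply: contraNneq vu => vr; have ve : v \in e by rewrite vr.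
      by rewrite (branch_meet acF eF ue ve fu vf).
    apply: eq_bigl => g; case vg: (v \in g); rewrite ?andbF ?andbT //.
    apply/idP/idP => [/(subsetP sbF)//|gF].
    exact: (branch_incident acF eF ue fu vf).
  (* At [u] the branch lacks exactly the edge [e], so 1 minus the sum over the branch is
     [beta u e]. *)
  - split => // ur; congr (_ * _); rewrite -(betaD u e ur eF ue) (bigD1 e) ?eF //=.
    rewrite [X in _ - X](eq_bigl (fun g => [&& g \in F, u \in g & g != e])).
      under [X in _ - X]eq_bigl do rewrite andbA.
      by rewrite addrK.
    by move=> g; apply: branch_incident_root.
have star e : e \in F -> r \in e ->
    matching_sum y (delete_vertex F r) != 0 /\
    y * matching_sum y (avoid F e) = matching_sum y (delete_vertex F r) * beta r e.
  move=> eF re; rewrite (matching_sum_delete_vertex y acF eF F0 re rF re).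
  rewrite (matching_sum_avoid y acF eF F0 re rF).
  have b0 v : v \in e -> beta v e != 0.
    move=> ve; apply: contraNneq y0 => bv.
    by rewrite -(betaM e eF) (big_setD1 v) //= bv mul0r.
  have [br0 _] := branchIH e r eF re re.
  have /esym yE := betaM e eF.
  rewrite (big_setD1 r) //= in yE; rewrite (big_setD1 (A := e) r) //=.
  have -> : \prod_(u in e :\ r) matching_sum y (branch F e u) =
      \prod_(u in e :\ r) matching_sum y (delete_vertex (branch F e u) u)
      * \prod_(u in e :\ r) beta u e.
    rewrite -big_split; apply: eq_bigr => u /setD1P[ur ue].
    by have [_ ->] := branchIH e u eF re ue.
  (* Writing [y] as the product of [beta] over [e], the factors at [u != r] turn root-deleted
     branches into full ones, and [beta r e] is left over. *)
  split; last by rewrite [X in X * _ = _]yE; ring.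
  rewrite !mulf_neq0 //; apply/prodf_neq0 => u /setD1P[ur ue]; last exact: b0.
  by have [] := branchIH e u eF re ue.
split.
  have [/exists_inP[e eF re]|none] := boolP [exists e in F, r \in e].
    by have [] := star e eF re.
  (* With no edge at the root, nothing else can be reached. *)
  suff -> : delete_vertex F r = set0 by rewrite matching_sum0 oner_neq0.
  apply/setP => f; rewrite !inE; apply/negP => /andP[fF rf].
  have /set0Pn[v vf] : f != set0 by apply: contraNneq F0 => <-.
  case/connectP: (rF f v fF vf) => -[/= _ vr|w p /= /andP[/hadjP[g [gF rg _]] _ _]].
    by rewrite -vr vf in rf.
  by case/negP: none; apply/exists_inP; exists g.
rewrite (matching_sum_star _ _ r) mulrBr mulr1 !mulr_sumr; congr (_ - _).
by apply: eq_bigr => e /andP[eF re]; have [] := star e eF re.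
Qed.

(** * Eigenvalue equations over edges, roots as matching sums, and choice of k-th roots *)

(** The [(k.-1)!] orderings of [e :\ j] cancel the normalization of the tensor. *)
Lemma adj_tensor_sum (K : numFieldType) (n k : nat) (E : {set {set 'I_n}})
    (x : 'I_n -> K) (j : 'I_n) :
    (0 < k)%N -> kuniform k E ->
  \sum_(t : {ffun 'I_k.-1 -> 'I_n}) adj_tensor K k E j t * \prod_(i : 'I_k.-1) x (t i)
  = \sum_(e in E | j \in e) \prod_(v in e :\ j) x v.
Proof.
move=> k0 kE; pose p (t : {ffun 'I_k.-1 -> 'I_n}) := j |: [set t i | i : 'I_k.-1].
transitivity (\sum_(t | p t \in E) (k.-1)`!%:R^-1 * \prod_i x (t i)).
  rewrite [RHS]big_mkcond; apply: eq_bigr => t _; rewrite /adj_tensor /p.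
  by case: ifP => // _; rewrite mul0r.
rewrite (partition_big p (fun e => (e \in E) && (j \in e))) /=; last first.
  by move=> t ->; rewrite setU11.
apply: eq_bigr => e /andP[eE je].
have ce : #|e :\ j| = k.-1 by move: (kE e eE); rewrite (cardsD1 j e) je => <-.
pose S := [set f in ffun_on (mem (e :\ j)) | injectiveb (f : {ffun 'I_k.-1 -> 'I_n})].
have imS t : t \in S -> [set t i | i : 'I_k.-1] = e :\ j.
  rewrite inE => /andP[/ffun_onP te /injectiveP ti]; apply/eqP.
  rewrite eqEcard ce card_imset // card_ord leqnn andbT.
  by apply/subsetP => v /imsetP[i _ ->]; apply: te.
have pS t : (p t \in E) && (p t == e) = (t \in S).
  apply/andP/idP => [[_ /eqP pt]|tS]; last by rewrite /p imS // setD1K.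
  (* To fill the [k] vertices of [e], the tuple must miss [j] and be injective. *)
  have cA : (#|[set t i | i : 'I_k.-1]| <= k.-1)%N.
    by apply: leq_trans (leq_imset_card _ _) _; rewrite card_ord.
  have := kE e eE; rewrite -pt /p cardsU1 => ck.
  have jA : j \notin [set t i | i : 'I_k.-1].
    case: (j \notin _) ck => //=; rewrite add0n => ck.
    by move: cA; rewrite ck -ltnS prednK // ltnn.
  rewrite jA add1n in ck.
  have ti : injective t.
    apply/injectiveP/injectiveP => a b; apply: (imset_injP (D := predT)) => //.
    by rewrite card_ord; apply/eqP; have /(congr1 predn) := ck.
  rewrite inE; apply/andP; split; last exact/injectiveP.
  apply/ffun_onP => i; rewrite -pt /p setU1K //.
  exact: imset_f.
rewrite (eq_bigl _ _ pS) (eq_bigr (fun _ => (k.-1)`!%:R^-1 * \prod_(v in e :\ j) x v)).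
  rewrite sumr_const card_inj_ffuns_on card_ord ce ffactnn -[LHS]mulr_natl mulrA.
  by rewrite mulfV ?mul1r // pnatr_eq0 -lt0n fact_gt0.
move=> t tS; congr (_ * _); rewrite -(imS t tS) big_imset //.
by move: tS; rewrite inE => /andP[_ /injectiveP ti] a b _ _; apply: ti.
Qed.

(** Group the matchings by size and factor out the nonzero power [lam ^+ (m * k)]. *)
Lemma root_matching_poly (K : fieldType) (n k : nat) (F : {set {set 'I_n}}) (lam : K) :
  lam != 0 -> root (matching_poly K k F) lam = (matching_sum (lam ^- k) F == 0).
Proof.
move=> lam0; rewrite /root /matching_poly horner_sum.
set m := max_matching F.
have leM M : is_matching F M -> (#|M| <= m)%N.
  by move=> mM; apply: (leq_bigmax_cond (F := fun M : {set {set 'I_n}} => #|M|)).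
have -> : matching_sum (lam ^- k) F
    = \sum_(i < m.+1) #|matchings F i|%:R * (- lam ^- k) ^+ i.
  rewrite /matching_sum (partition_big (fun M : {set {set 'I_n}} => inord #|M| : 'I_m.+1) predT) //=.
  apply: eq_bigr => i _; rewrite mulr_natl -sumr_const.
  apply: eq_big => [M|M /andP[mM /eqP <-]].
    rewrite inE; case mM: (is_matching F M) => //=.
    by rewrite -val_eqE /= inordK // ltnS leM.
  by rewrite inordK // ltnS leM.
rewrite -[RHS](mulrI_eq0 _ (x := lam ^+ (m * k))); last first.
  by apply/mulfI; rewrite expf_neq0.
rewrite mulr_sumr; congr (_ == 0); apply: eq_bigr => i _.
rewrite hornerZ hornerXn mulnBl [RHS]mulrCA -mulrA [LHS]mulrCA; congr (_ * _).
rewrite (exprNn (lam ^- k)) [RHS]mulrCA; congr (_ * _).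
have ik : (i * k <= m * k)%N by rewrite leq_mul2r -ltnS ltn_ord orbT.
rewrite -{2}(subnK ik) exprD -mulrA exprVn -exprM [(k * i)%N]mulnC divff ?mulr1 //.
by rewrite expf_neq0.
Qed.

(* Multiplying [x] by a k-th root of unity on a connected component of [F :\ e] affects
   only the product over [e]. *)
Lemma adjust_edge_products (K : fieldType) (n k : nat) (F : {set {set 'I_n}})
    (x0 : 'I_n -> K) (t : {set 'I_n} -> K) :
    (0 < k)%N -> kuniform k F -> ~ has_berge_cycle F ->
    (forall e, e \in F -> t e != 0 /\ \prod_(v in e) x0 v ^+ k = t e ^+ k) ->
  exists x, (forall v, x v ^+ k = x0 v ^+ k) /\
            (forall e, e \in F -> \prod_(v in e) x v = t e).
Proof.
move=> k0; have [m] := ubnP #|F|; elim: m => // m IH in F *.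
rewrite ltnS => Fm kF acF tF.
have [->|/set0Pn[e eF]] := eqVneq F set0.
  by exists x0; split => // e; rewrite inE.
have [|||f /setD1P[_ fF]|x [xk xF]] := IH (F :\ e).
- by move: Fm; rewrite (cardsD1 e F) eF.
- by move=> f /setD1P[_ fF]; apply: kF.
- by apply: contra_not acF; apply/has_berge_cycleS/subD1set.
- exact: tF.
have /set0Pn[u ue] : e != set0 by rewrite -card_gt0 kF.
have [te0 teP] := tF e eF.
have Pk : (\prod_(v in e) x v) ^+ k = t e ^+ k.
  by rewrite -prodrXl -teP; apply: eq_bigr => v _.
have P0 : \prod_(v in e) x v != 0.
  apply: contraNneq te0 => P0; move/eqP: Pk.
  by rewrite P0 expr0n eqn0Ngt k0 /= eq_sym expf_eq0 k0.
pose c := t e / \prod_(v in e) x v.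
have ck : c ^+ k = 1 by rewrite expr_div_n Pk divff // expf_neq0.
(* The component of [u] meets [e] only in [u], so the product over [e] gains one factor [c]. Any
   other edge lies inside or outside the component and gains [c ^+ k = 1] or nothing. *)
pose x' v := if connect (hadj (F :\ e)) u v then c * x v else x v.
exists x'; split => [v|f fF].
  by rewrite /x'; case: ifP => // _; rewrite exprMn ck mul1r.
have [->|fe] := eqVneq f e.
  rewrite (big_setD1 u) //= {1}/x' connect0 -mulrA.
  rewrite (eq_bigr x) => [|v /setD1P[vu ve]]; first by rewrite -big_setD1 // divfK.
  rewrite /x'; case: ifP => // uv; case/eqP: vu.
  exact/esym/(acyclic_edge_cut acF eF ue ve uv).
have fF' : f \in F :\ e by rewrite !inE fe.
rewrite -(xF f fF').
have [/exists_inP[w wf uw]|none] := boolP [exists w in f, connect (hadj (F :\ e)) u w].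
  rewrite (eq_bigr (fun v => c * x v)) => [|v vf].
    by rewrite big_split /= prodr_const (kF f fF) ck mul1r.
  by rewrite /x' (connect_trans uw (connect_edge fF' wf vf)).
apply: eq_bigr => v vf; rewrite /x'; case: ifP => // uv.
by case/negP: none; apply/exists_inP; exists v.
Qed.

(** * Eigenvectors and vanishing matching sums *)

Section Eigenvalue.

Variables (K : numClosedFieldType) (n k : nat) (E : {set {set 'I_n}}) (lam : K).
Hypotheses (k3 : (3 <= k)%N) (kE : kuniform k E) (acE : ~ has_berge_cycle E).
Hypothesis lam0 : lam != 0.

Let k0 : (0 < k)%N. Proof. exact: leq_trans k3. Qed.

Lemma induced_sub (U : {set 'I_n}) : induced E U \subset E.
Proof. by apply/subsetP => e; rewrite inE => /andP[]. Qed.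

Lemma induced_acyclic (U : {set 'I_n}) : ~ has_berge_cycle (induced E U).
Proof. by apply: contra_not acE; apply/has_berge_cycleS/induced_sub. Qed.

Lemma induced_edge_neq0 (U : {set 'I_n}) : set0 \notin induced E U.
Proof. by rewrite inE; apply/negP => /andP[/kE]; rewrite cards0; move: k0 => /[swap] <-. Qed.

Lemma eigenvalue_matching_sum : is_eigenvalue K k E lam ->
  exists U, hconnected U (induced E U) /\ matching_sum (lam ^- k) (induced E U) = 0.
Proof.
case=> x [[r xr] eqx].
(* The equation at [j], multiplied by [x j]. *)
have {}eqx j : \sum_(e in E | j \in e) \prod_(v in e) x v = lam * x j ^+ k.
  rewrite -[in RHS](prednK k0) exprS mulrCA -eqx adj_tensor_sum // mulr_sumr.
  by apply: eq_bigr => e /andP[_ je]; rewrite (big_setD1 j).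
pose S := [set v | x v != 0]; pose G := induced E S.
pose U := [set v | connect (hadj G) r v]; pose F := component_edges G r.
have US v : v \in U -> x v != 0.
  rewrite inE; apply: (connect_invariant (P := fun v => x v != 0)) => // a b _ _.
  by case/hadjP => e [+ _ be]; rewrite inE => /andP[_ /subsetP/(_ b be)]; rewrite inE.
have FE : induced E U = F.
  apply/setP => f; apply/idP/idP => [fU|fF].
    have /set0Pn[v vf] : f != set0.
      by apply: contraNneq (induced_edge_neq0 U) => <-.
    move: fU; rewrite inE => /andP[fE /subsetP fU].
    have := fU v vf; rewrite inE => rv; apply: component_edgeI vf rv.
    by rewrite inE fE; apply/subsetP => w /fU/US; rewrite inE.
  rewrite inE (subsetP (induced_sub S)) ?(subsetP (component_edges_sub G r)) //=.
  by apply/subsetP => v vf; rewrite inE; apply: mem_component fF vf.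
have rU v : v \in U -> connect (hadj F) r v.
  by rewrite inE; apply: connect_component.
exists U; rewrite FE; split.
  by move=> u v uU vU; apply: connect_trans (rU v vU); rewrite connect_hadjC rU.
have acF : ~ has_berge_cycle F by rewrite -FE; apply: induced_acyclic.
have F0 : set0 \notin F by rewrite -FE; apply: induced_edge_neq0.
have FU f v : f \in F -> v \in f -> v \in U.
  by rewrite -FE inE => /andP[_ /subsetP]; apply.
have eqF v : v \in U -> \sum_(e in F | v \in e) \prod_(w in e) x w = lam * x v ^+ k.
  (* An edge at [v] with nonzero product lies in the support, hence in the component [F]; all others
     contribute 0. *)
  move=> vU; rewrite -eqx [RHS](bigID (mem F)) /= [X in _ + X]big1 ?addr0.
    apply: eq_bigl => e; rewrite [RHS]andbC; case eF: (e \in F) => //=.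
    by move: eF; rewrite -FE inE => /andP[->].
  move=> e /andP[/andP[eE ve]]; apply: contraNeq => /prodf_neq0 xe.
  apply: (component_edgeI (v := v)) => //; last by rewrite inE in vU.
  by rewrite inE eE; apply/subsetP => w we; rewrite inE xe.
pose beta v (e : {set 'I_n}) := (\prod_(w in e) x w) / (lam * x v ^+ k).
have d0 v : v \in U -> lam * x v ^+ k != 0.
  by move=> vU; rewrite mulf_neq0 ?expf_neq0 ?US.
have betaD v : v \in U -> \sum_(e in F | v \in e) beta v e = 1.
  by move=> vU; rewrite /beta -mulr_suml eqF // divff ?d0.
have [||e eF|v f _ fF vf|_ ->] :=
    matching_sum_rooted (y := lam ^- k) (r := r) (beta := beta) acF F0.
- exact: reaches_component.
- by rewrite invr_eq0 expf_neq0.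
- have eE : e \in E by move: eF; rewrite -FE inE => /andP[].
  rewrite /beta big_split /= prodr_const (kE eE) prodfV big_split /= prodr_const (kE eE).
  rewrite prodrXl invfM mulrCA divff ?mulr1 // expf_neq0 //.
  by apply/prodf_neq0 => v /(FU e v eF)/US.
- exact: betaD (FU f v fF vf).
(* The equation also holds at the root, which annihilates the last factor. *)
- by rewrite betaD ?subrr ?mulr0 // inE connect0.
Qed.

Lemma matching_sum_eigenvalue (U0 : {set 'I_n}) :
  matching_sum (lam ^- k) (induced E U0) = 0 -> is_eigenvalue K k E lam.
Proof.
set y := lam ^- k => msU0.
have y0 : y != 0 by rewrite invr_eq0 expf_neq0.
have [U /minsetP[/eqP msU minU] {U0 msU0}] :
    {U | minset (fun U => matching_sum y (induced E U) == 0) U}.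
  by apply: ex_minset; exists U0; apply/eqP.
set F := induced E U in msU.
have F0 : set0 \notin F by apply: induced_edge_neq0.
have acF : ~ has_berge_cycle F by apply: induced_acyclic.
have FU e : e \in F -> e \subset U by rewrite inE => /andP[].
have FE e : e \in F -> e \in E by rewrite inE => /andP[].
have proper_neq0 (W : {set 'I_n}) : W \proper U -> matching_sum y (induced E W) != 0.
  move=> /properP[sWU [v vU vW]]; apply: contraNneq vW => /eqP msW.
  by rewrite (minU W msW sWU).
(* The matching sum factors over [U :&: W] and [U :\: W], with [W] the component of [u]. The second
   factor is nonzero, so the first vanishes and minimality gives [U :&: W = U]. *)
have connU u v : u \in U -> v \in U -> connect (hadj F) u v.
  move=> uU vU; pose W := [set w | connect (hadj F) u w].
  have FW e w w' : e \in F -> w \in e -> w' \in e -> w \in W -> w' \in W.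
    rewrite !inE => /andP[eE eU] we w'e uw; apply: connect_trans uw (connect_edge _ we w'e).
    by rewrite inE eE.
  have FUE : F = induced E (U :&: W) :|: induced E (U :\: W).
    apply/setP => f; rewrite in_setU; apply/idP/orP.
      move=> fF; have fE := FE f fF; have fU := FU f fF.
      have [/exists_inP[w wf wW]|none] := boolP [exists w in f, w \in W].
        left; rewrite inE fE subsetI fU; apply/subsetP => w' w'f.
        exact: FW fF wf w'f wW.
      right; rewrite inE fE subsetD fU -setI_eq0; apply: contraNT none.
      by move=> /set0Pn[w /setIP[wf wW]]; apply/exists_inP; exists w.
    by case; rewrite !inE => /andP[-> fs]; apply: subset_trans fs _;
       [apply: subsetIl | apply: subsetDl].
  have uW : u \in W by rewrite inE.
  have ms2 : matching_sum y (induced E (U :\: W)) != 0.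
    apply: proper_neq0; apply/properP; split; first exact: subsetDl.
    by exists u; rewrite // inE uW.
  suff UW : U :&: W = U.
    by have /setIP[_] : v \in U :&: W; rewrite ?UW // inE.
  apply: minU (subsetIl _ _); move: msU.
  rewrite FUE matching_sumU ?induced_edge_neq0 //; last first.
    move=> f g; rewrite !inE => /andP[_ /subsetP fU] /andP[_ /subsetP gU].
    rewrite -setI_eq0; apply/set0Pn => -[w /setIP[/fU/setIP[_ wW] /gU/setDP[_]]].
    by rewrite wW.
  by move/eqP; rewrite mulf_eq0 (negPf ms2) orbF.
have reachF r : r \in U -> reaches F r.
  by move=> rU f v fF vf; apply: connU => //; apply: (subsetP (FU f fF)).
pose z v := matching_sum y (delete_vertex F v).
pose w e := matching_sum y (avoid F e).
have z0 v : v \in U -> z v != 0.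
  move=> vU; rewrite /z (_ : delete_vertex F v = induced E (U :\ v)).
    by apply: proper_neq0; rewrite properD1.
  by apply/setP => f; rewrite !inE subsetD1 andbA.
have w0 e : e \in F -> w e != 0.
  move=> eF; have /set0Pn[v ve] : e != set0 by apply: contraNneq F0 => <-.
  rewrite /w (_ : avoid F e = induced E (U :\: e)).
    apply: proper_neq0; apply/properP; split; first exact: subsetDl.
    by exists v; rewrite ?inE ?ve // (subsetP (FU e eF)).
  by apply/setP => f; rewrite !inE subsetD andbA.
have zw v : v \in U -> \sum_(e in F | v \in e) y * w e = z v.
  move=> vU; move/eqP: msU; rewrite (matching_sum_star _ _ v) subr_eq0 -mulr_sumr.
  by move/eqP.
have prod_z e : e \in F -> \prod_(v in e) z v = (lam * (y * w e)) ^+ k.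
  move=> eF; have /set0Pn[r re] : e != set0 by apply: contraNneq F0 => <-.
  have rF := reachF r (subsetP (FU e eF) r re).
  (* As the sum of [F] vanishes, the product of [a] over [e] is [y * w e], while that of [b] is
     [w e]. Since [z v = b v * (y * w e) / a v], the product of [z] is [(y * w e) ^+ k / y], and
     [1 / y = lam ^+ k]. *)
  pose a u := matching_sum y (branch F e u).
  pose b u := matching_sum y (delete_vertex (branch F e u) u).
  have aE : \prod_(u in e) a u = y * w e.
    rewrite -(matching_sum_del_edge y acF eF F0 re rF); apply/eqP.
    rewrite -subr_eq0 -[X in _ == X]msU (matching_sum_edge y eF) //.
    by apply/set0Pn; exists r.
  have bE : \prod_(u in e) b u = w e by rewrite /w (matching_sum_avoid y acF eF F0 re rF).
  have a0 u : u \in e -> a u != 0.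
    by move: u; apply/prodf_neq0; rewrite aE mulf_neq0 ?w0.
  rewrite (eq_bigr (fun v => b v * (y * w e) / a v)) => [|v ve]; last first.
    rewrite /z (matching_sum_delete_vertex y acF eF F0 re rF ve) -mulrA; congr (_ * _).
    by rewrite -aE [in RHS](big_setD1 v) //= [RHS]mulrC mulKf ?a0.
  rewrite 2!big_split prodfV prodr_const (kE (FE e eF)) aE bE /= [in RHS]exprMn.
  rewrite -[lam ^+ k]invrK -/y; set q := (y * w e) ^+ k.
  by field; rewrite y0 w0.
have [x [xk xF]] : exists x, (forall v, x v ^+ k = (k.-root (z v)) ^+ k) /\
    (forall e, e \in F -> \prod_(v in e) x v = lam * (y * w e)).
  apply: adjust_edge_products => // [e /FE|e eF]; first exact: kE.
  rewrite !mulf_neq0 ?w0 //; split => //; rewrite -prod_z //.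
  by apply: eq_bigr => v _; rewrite rootCK.
have {}xk v : x v ^+ k = z v by rewrite xk rootCK.
have x0 v : v \in U -> x v != 0.
  by move=> vU; apply: contraNneq (z0 v vU) => xv; rewrite -xk xv expr0n eqn0Ngt k0.
have /set0Pn[r rU] : U != set0.
  apply: contra_eqN msU => /eqP U0; rewrite (_ : F = set0) ?matching_sum0 ?oner_neq0 //.
  apply/setP => f; rewrite [RHS]inE; apply/negP => fF.
  by case/negP: F0; move: (FU f fF); rewrite U0 subset0 => /eqP <-.
pose X v := if v \in U then x v else 0.
exists X; split; first by exists r; rewrite /X rU x0.
move=> j; rewrite (adj_tensor_sum X) //.
have outside (e : {set 'I_n}) v : v \in e -> v \notin U -> j != v ->
    \prod_(u in e :\ j) X u = 0.
  move=> ve vU jv; rewrite (bigD1 v) /=; last by rewrite !inE eq_sym jv.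
  by rewrite /X (negPf vU) mul0r.
rewrite {2}/X; case: ifPn => jU; last first.
  have -> : 0 ^+ k.-1 = 0 :> K by rewrite expr0n eqn0Ngt -ltnS prednK // (ltnW k3).
  rewrite mulr0.
  apply: big1 => e /andP[eE je].
  (* [e] has two vertices other than [j]; if both were in [U] they would be joined
     by a path avoiding [e]. *)
  have [u uej] : exists u, u \in e :\ j.
    apply/set0Pn; rewrite -card_gt0 -ltnS; have := kE eE.
    by rewrite (cardsD1 j e) je add1n => ->; apply: ltnW.
  have [v vej] : exists v, v \in (e :\ j) :\ u.
    apply/set0Pn; rewrite -card_gt0 -2!ltnS; have := kE eE.
    by rewrite (cardsD1 j e) je (cardsD1 u (e :\ j)) uej !add1n => ->.
  move: vej uej => /setD1P[vu /setD1P[vj ve]] /setD1P[uj ue].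
  have [uU|uU] := boolP (u \in U); last by apply: (outside e u); rewrite // eq_sym.
  have [vU|vU] := boolP (v \in U); last by apply: (outside e v); rewrite // eq_sym.
  case/eqP: vu; apply: (acyclic_edge_cut acE eE ve ue).
  apply: connect_hadjS (connU v u vU uU); rewrite subsetD1 induced_sub inE eE /=.
  by apply: contra jU => /subsetP/(_ j je).
rewrite (bigID (mem F)) /= [X in _ + X]big1 ?addr0; last first.
  move=> e /andP[/andP[eE je]]; rewrite inE eE /= => /subsetPn[v ve vU].
  by apply: (outside e v) => //; apply: contraNneq vU => <-.
(* After multiplication by [x j], both sides are sums of [lam * (y * w e)] over the edges of [F] at
   [j]. *)
apply: (mulfI (x0 j jU)); rewrite mulrCA -exprS prednK // xk -zw // !mulr_sumr.
apply: eq_big => [e|e /andP[/andP[eE je] eF]].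
  by rewrite andbC; case eF: (e \in F); rewrite //= FE.
rewrite -xF // [in RHS](big_setD1 j) //=; congr (_ * _); apply: eq_bigr => v /setD1P[_ ve].
by rewrite /X (subsetP (FU e eF) v ve).
Qed.

End Eigenvalue.

Theorem theorem2 (C : numClosedFieldType) (n k : nat) (E : {set {set 'I_n}})
  (lam : C) :
  (3 <= k)%N -> kuniform k E -> hypertree [set: 'I_n] E -> lam != 0 ->
  (is_eigenvalue C k E lam <->
   exists U : {set 'I_n},
     hconnected U (induced E U) /\ root (matching_poly C k (induced E U)) lam).
Proof.
move=> k3 kE [_ acE] lam0; split=> [/eigenvalue_matching_sum|].
  move=> /(_ k3 kE acE lam0)[U [cU msU]]; exists U; split => //.
  by rewrite root_matching_poly // msU.
case=> U [_]; rewrite root_matching_poly // => /eqP.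
exact: matching_sum_eigenvalue.
Qed.
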